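(* Let $(X,\varphi,x)$ be a pointed Cantor minimal system. Then $(X,\varphi,x)$ is (pointed) topologically conjugate to a pointed minimal subshift over some finite alphabet if and only if $\mathrm{Ret}(X,\varphi,x)$ is finitely generated.
   Context: A pointed Cantor minimal system is $(X,\varphi,x)$ with $X$ a Cantor space, $\varphi$ a homeomorphism of $X$ with no non-empty proper closed invariant subsets, and $x\in X$; pointed topological conjugacy between $(X,\varphi,x)$ and $(Y,\psi,y)$ is a homeomorphism $\pi:X\to Y$ with $\pi\circ\varphi=\psi\circ\pi$ and $\pi(x)=y$. A subshift over a finite alphabet $\mathfrak{a}$ is $(O,\sigma)$ with $O$ a closed $\sigma$-invariant subset of $\mathfrak{a}^{\mathbb{Z}}$ and $\sigma$ the left shift $(\sigma\alpha)(i)=\alpha(i+1)$; it is minimal if $(O,\sigma)$ has no non-empty proper closed invariant subsets; minimal subshifts are assumed infinite; a pointed minimal subshift is $(O,\sigma,w)$ with $w\in O$. For clopen $U\subseteq X$, $\mathrm{Ret}_U(X,\varphi,x)=\{i\in\mathbb{Z}:\varphi^i(x)\in U\}$ and $\mathrm{Ret}(X,\varphi,x)=\{\mathrm{Ret}_U(X,\varphi,x):U\text{ clopen}\}$. With $\xi(A)=\{a-1:a\in A\}$ for $A\subseteq\mathbb{Z}$, a Boolean subalgebra $\mathcal{A}\subseteq\mathcal{P}(\mathbb{Z})$ closed under $\xi,\xi^{-1}$ is finitely generated if there is a finite $F\subseteq\mathcal{A}$ such that $\mathcal{A}$ is the Boolean algebra generated by $\{\xi^k(A):A\in F,k\in\mathbb{Z}\}$.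 *)

(* Defs.v *)
From HB Require Import structures.
From mathcomp Require Import all_boot all_order all_algebra.
From mathcomp Require Import all_classical topology cantor.
From mathcomp Require Import measurable_structure.

Set Implicit Arguments.
Unset Strict Implicit.
Unset Printing Implicit Defensive.

Import GRing.Theory.

Local Open Scope classical_set_scope.
Local Open Scope ring_scope.

Record homeo (X Y : topologicalType) := Homeo {
  homeo_fun :> X -> Y;
  homeo_inv : Y -> X;
  homeo_funK : cancel homeo_fun homeo_inv;
  homeo_invK : cancel homeo_inv homeo_fun;
  homeo_continuous : continuous homeo_fun;
  homeo_inv_continuous : continuous homeo_inv
}.

(* The power f^i for i in Z, where g is the inverse of f. *)
Definition ziter {T : Type} (f g : T -> T) (i : int) : T -> T :=
  match i with
  | Posz n => iter n f
  | Negz n => iter n.+1 g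
  end.

Definition homeo_pow (X : topologicalType) (phi : homeo X X) : int -> X -> X :=
  ziter phi (homeo_inv phi).

(* The library's [cantor_like] does not include metrizability, so it would
   also allow non-metrizable spaces. *)
Definition is_cantor_space (X : topologicalType) : Prop :=
  inhabited (homeo X cantor_space).

Definition invariant_set (X : topologicalType) (phi : homeo X X) (C : set X) :=
  phi @` C = C.

Definition minimal_system (X : topologicalType) (phi : homeo X X) : Prop :=
  forall C : set X, closed C -> invariant_set phi C -> C !=set0 ->
    C = [set: X].

Definition pointed_conjugate (X Y : topologicalType)
    (phi : homeo X X) (x : X) (psi : homeo Y Y) (y : Y) : Prop :=
  exists pi : homeo X Y, pi \o phi = psi \o pi /\ pi x = y.

Section Restriction.
Variables (X : topologicalType) (phi : homeo X X) (O : set X).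
Hypothesis invO : invariant_set phi O.

Lemma invariant_fun (u : O) : phi (val u) \in O.
Proof.
apply/mem_set; have : (phi @` O) (phi (val u)).
  by exists (val u) => //; exact: set_valP.
by rewrite invO.
Qed.

Lemma invariant_inv (u : O) : homeo_inv phi (val u) \in O.
Proof.
apply/mem_set; have : (phi @` O) (val u) by rewrite invO; exact: set_valP.
by move=> [v Ov <-]; rewrite homeo_funK.
Qed.

Definition restr_fun (u : O) : O := exist _ (phi (val u)) (invariant_fun u).

Definition restr_inv (u : O) : O :=
  exist _ (homeo_inv phi (val u)) (invariant_inv u).

Lemma restr_funK : cancel restr_fun restr_inv.
Proof. by move=> u; apply: val_inj; exact: homeo_funK. Qed.

Lemma restr_invK : cancel restr_inv restr_fun.
Proof. by move=> u; apply: val_inj; exact: homeo_invK. Qed.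

Lemma restr_fun_continuous : continuous restr_fun.
Proof.
apply/continuousP => _ [B oB <-].
have oC : open (phi @^-1` B).
  by move: B oB; apply/continuousP; exact: homeo_continuous.
by exists (phi @^-1` B).
Qed.

Lemma restr_inv_continuous : continuous restr_inv.
Proof.
apply/continuousP => _ [B oB <-].
have oC : open (homeo_inv phi @^-1` B).
  by move: B oB; apply/continuousP; exact: homeo_inv_continuous.
by exists (homeo_inv phi @^-1` B).
Qed.

(* O carries the subspace topology of the library's [set_type]. *)
Definition homeo_restr : homeo O O :=
  Homeo restr_funK restr_invK restr_fun_continuous restr_inv_continuous.

End Restriction.

Definition full_shift (A : finType) : topologicalType :=
  {ptws int -> discrete_topology A}.

Definition shift_fun (A : finType) (a : full_shift A) : full_shift A :=
  fun i : int => a (i + 1).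

Definition shift_inv (A : finType) (a : full_shift A) : full_shift A :=
  fun i : int => a (i - 1).

Lemma shift_funK (A : finType) : cancel (@shift_fun A) (@shift_inv A).
Proof. by move=> a; apply/funext => i; rewrite /shift_inv /shift_fun subrK. Qed.

Lemma shift_invK (A : finType) : cancel (@shift_inv A) (@shift_fun A).
Proof. by move=> a; apply/funext => i; rewrite /shift_inv /shift_fun addrK. Qed.

Lemma reindex_continuous (I : eqType) (K : topologicalType) (r : I -> I)
    (f : {ptws I -> K} -> {ptws I -> K}) :
  (forall a i, f a i = a (r i)) ->
  continuous f.
Proof.
move=> fE a.
have FF : Filter (f @ nbhs a) by apply: fmap_filter.
refine (iffRL (@cvg_sup _ _ _ _ _ FF) _).
move=> i /=; clear FF; move: a.
apply/(@continuousP _ (initial_topology (@^~ i))) => _ [B oB <-].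
have oP : open ((@^~ (r i) : {ptws I -> K} -> K) @^-1` B).
  by move: B oB; apply/continuousP; exact: (@proj_continuous _ (fun=> K)).
rewrite (_ : _ @^-1` _ = (@^~ (r i) : {ptws I -> K} -> K) @^-1` B) //.
by apply/seteqP; split => a /=; rewrite fE.
Qed.

Lemma shift_fun_continuous (A : finType) : continuous (@shift_fun A).
Proof.
exact: (@reindex_continuous _ (discrete_topology A) (fun i : int => i + 1)).
Qed.

Lemma shift_inv_continuous (A : finType) : continuous (@shift_inv A).
Proof.
exact: (@reindex_continuous _ (discrete_topology A) (fun i : int => i - 1)).
Qed.

Definition shift (A : finType) : homeo (full_shift A) (full_shift A) :=
  Homeo (@shift_funK A) (@shift_invK A)
    (@shift_fun_continuous A) (@shift_inv_continuous A).

Definition is_subshift (A : finType) (O : set (full_shift A)) : Prop :=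
  closed O /\ invariant_set (@shift A) O.

(* Minimal subshifts are infinite by convention. *)
Definition is_minimal_subshift (A : finType) (O : set (full_shift A))
    (sO : is_subshift O) : Prop :=
  minimal_system (homeo_restr (proj2 sO)) /\ infinite_set O.

Definition ret_set (X : topologicalType) (phi : homeo X X) (x : X)
    (U : set X) : set int :=
  [set i | U (homeo_pow phi i x)].

Definition ret (X : topologicalType) (phi : homeo X X) (x : X) :
    set (set int) :=
  [set ret_set phi x U | U in clopen].

Definition xi (B : set int) : set int := [set b - 1 | b in B].

Definition xi_inv (B : set int) : set int := [set b + 1 | b in B].

Lemma xiK : cancel xi xi_inv.
Proof.
move=> B; apply/seteqP; split=> b.
  by move=> [_ [c Bc <-] <-]; rewrite subrK.
by move=> Bb; exists (b - 1); [exists b | rewrite subrK].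
Qed.

Lemma xi_invK : cancel xi_inv xi.
Proof.
move=> B; apply/seteqP; split=> b.
  by move=> [_ [c Bc <-] <-]; rewrite addrK.
by move=> Bb; exists (b + 1); [exists b | rewrite addrK].
Qed.

Definition boolean_subalgebra {T : Type} (C : set (set T)) : Prop :=
  [/\ C set0, setU_closed C & setC_closed C].

(* Requires, by the last clause, that C is a Boolean subalgebra closed under
   xi and its inverse. *)
Definition finitely_generated (C : set (set int)) : Prop :=
  exists F : set (set int), [/\ finite_set F, F `<=` C &
    C = smallest boolean_subalgebra
          [set ziter xi xi_inv k B | B in F & k in [set: int]]].

(* Main.v *)
(* Shifting a return set by [xi] corresponds to pulling the clopen set back by
   [phi]. For a subshift, the translates of the finitely many sets [u 0 = a] are
   clopen and separate points, so by compactness they generate all clopen sets.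
   Conversely, if the return sets of the clopen sets [U_1], ..., [U_n] generate
   [Ret], code each point by its visits to the [U_j]. Since orbits are dense, a
   clopen set is determined by its return set, hence every clopen set lies in the
   algebra generated by the translates of the [U_j]. Two points with the same code
   are then in the same clopen sets, so the code is a homeomorphism onto a
   subshift. *)
Require Import Defs.
From mathcomp Require Import all_boot all_order all_algebra.
From mathcomp Require Import all_classical topology cantor.

Local Open Scope classical_set_scope.

(** * Integer powers of an invertible map and translates of return sets *)

Section IntegerIterates.
Context {T : Type} {f g : T -> T} (fK : cancel f g) (gK : cancel g f).

Lemma ziterS i z : ziter f g (i + 1)%R z = f (ziter f g i z).
Proof.
case: i => [n|[|n]]; first by rewrite -PoszD addn1.
  by rewrite /= gK.
have -> : (Negz n.+1 + 1 = Negz n)%R.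
  by rewrite !NegzE -[n.+2]addn1 PoszD GRing.opprD GRing.subrK.
by rewrite [in RHS]/= gK.
Qed.

Lemma ziterP i z : ziter f g (i - 1)%R z = g (ziter f g i z).
Proof. by rewrite -[in RHS](GRing.subrK 1%R i) ziterS fK. Qed.

Lemma ziterD i j z : ziter f g (i + j)%R z = ziter f g i (ziter f g j z).
Proof.
elim/int_rect: i => [|n IH|n IH]; first by rewrite GRing.add0r.
  by rewrite -addn1 PoszD GRing.addrAC !ziterS IH.
by rewrite -addn1 PoszD GRing.opprD GRing.addrAC !ziterP IH.
Qed.

End IntegerIterates.

(** Each [xi] lowers every element by one, so membership after it is read one place further to the
    right. *)
Lemma ziter_xiE k (B : set int) i : ziter xi xi_inv k B i = B (i + k)%R.
Proof.
have xiE C j : xi C j = C (j + 1)%R.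
  apply/propext; split=> [[c Cc <-]|Cj]; first by rewrite GRing.subrK.
  by exists (j + 1)%R; rewrite ?GRing.addrK.
have xi_invE C j : xi_inv C j = C (j - 1)%R.
  by rewrite -[in RHS](xi_invK C) xiE GRing.subrK.
elim/int_rect: k i => [i|n IH i|n IH i]; first by rewrite GRing.addr0.
  by rewrite -addn1 PoszD (ziterS xi_invK) xiE IH -GRing.addrA (GRing.addrC 1%R).
by rewrite -addn1 PoszD GRing.opprD (ziterP xiK xi_invK) xi_invE IH -GRing.addrA
  (GRing.addrC (-1)%R).
Qed.

Section Powers.
Context {X : topologicalType} (phi : homeo X X).

Lemma homeo_powD i j z :
  homeo_pow phi (i + j)%R z = homeo_pow phi i (homeo_pow phi j z).
Proof. exact: ziterD (homeo_funK phi) (homeo_invK phi) i j z. Qed.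

Lemma homeo_pow_continuous i : continuous (homeo_pow phi i).
Proof.
have iter_continuous (h : X -> X) n : continuous h -> continuous (iter n h).
  move=> hc; elim: n => [|n IH] z; first exact: cvg_id.
  by apply: continuous_comp; [exact: IH|exact: hc].
case: i => n; apply: iter_continuous;
  [exact: homeo_continuous|exact: homeo_inv_continuous].
Qed.

Lemma ret_set_preimage x k (U : set X) :
  ret_set phi x (homeo_pow phi k @^-1` U) = ziter xi xi_inv k (ret_set phi x U).
Proof.
by apply/funext => i; rewrite ziter_xiE /ret_set /= GRing.addrC homeo_powD.
Qed.

End Powers.

(** Stated for an arbitrary map [p], since it serves both for conjugacies and for the inclusion
    [val] of an invariant set. *)
Lemma pow_conjugate {X Y : topologicalType} {phi : homeo X X} {psi : homeo Y Y}
    {p : X -> Y} : p \o phi = psi \o p ->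
  forall i z, p (homeo_pow phi i z) = homeo_pow psi i (p z).
Proof.
move=> pE.
have pS z : p (phi z) = psi (p z) by have := congr1 (@^~ z) pE.
have pV z : p (homeo_inv phi z) = homeo_inv psi (p z).
  by rewrite -{2}(homeo_invK phi z) pS homeo_funK.
have iterE f g : (forall z, p (f z) = g (p z)) ->
    forall n z, p (iter n f z) = iter n g (p z).
  by move=> fg n z; elim: n => [//|n IH] /=; rewrite fg IH.
by case=> n z; exact: iterE.
Qed.

(** * Boolean subalgebras of clopen sets and of return sets *)

Section Algebras.
Context {T : Type} {C : set (set T)} (algC : boolean_subalgebra C).

Lemma subalgebraI : setI_closed C.
Proof.
have [_ CU CC] := algC => A B CA CB.
by rewrite -(setCK (A `&` B)) setCI; apply/CC/CU; apply: CC.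
Qed.

Lemma subalgebraT : C setT.
Proof. by have [C0 _ CC] := algC; rewrite -setC0; apply: CC. Qed.

End Algebras.

Lemma smallest_subalgebra {T : Type} (G : set (set T)) :
  boolean_subalgebra (smallest boolean_subalgebra G).
Proof.
split=> [D [[D0 _ _] _]//|A B hA hB D hD|A hA D hD].
- by have [[_ DU _] _] := hD; apply: DU; [exact: hA|exact: hB].
- by have [[_ _ DC] _] := hD; apply: DC; exact: hA.
Qed.

Lemma clopen_subalgebra (X : topologicalType) : boolean_subalgebra (@clopen X).
Proof. by split; [exact: clopen0|exact: clopenU|move=> A; exact: clopenC]. Qed.

(** Taking return sets commutes with union and complement, so a subalgebra of sets of integers pulls
    back to one of clopen sets. *)
Lemma preimage_ret_subalgebra {X : topologicalType} (phi : homeo X X) x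
    (C : set (set int)) : boolean_subalgebra C ->
  boolean_subalgebra [set U : set X | clopen U /\ C (ret_set phi x U)].
Proof.
case: (clopen_subalgebra X) => cl0 clU clC [C0 CU CC]; split.
- by split.
- by move=> U V [cU CrU] [cV CrV]; split; [exact: clU|exact: CU].
- by move=> U [cU CrU]; split; [exact: clC|exact: CC].
Qed.

Lemma ret_subalgebra {X : topologicalType} (phi : homeo X X) x :
  boolean_subalgebra (ret phi x).
Proof.
case: (clopen_subalgebra X) => cl0 clU clC; split.
- by exists set0.
- by move=> _ _ [U cU <-] [V cV <-]; exists (U `|` V); [exact: clU|].
- by move=> _ [U cU <-]; exists (~` U); [exact: clC|].
Qed.

(** A Boolean form of the Stone-Weierstrass theorem. Compactness enters twice: to place a member of
    [G] between a given point of [U] and [U], then to exhaust [U] by a single member. *)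
Lemma separating_algebra_clopen {X : topologicalType} (G : set (set X)) :
  compact [set: X] -> boolean_subalgebra G -> G `<=` clopen ->
  (forall z z', z <> z' -> exists V, [/\ G V, V z & ~ V z']) ->
  clopen `<=` G.
Proof.
move=> cX algG Gcl sep U [oU cU].
have [G0 GU GC] := algG.
have cpt (A : set X) : closed A -> compact A.
  by move=> cA; exact: (subclosed_compact cA cX).
(* Otherwise the sets [W `\` U], with [W] in [G] containing [z], cluster at some
   point outside [U], which [G] separates from [z]. *)
have nbhsG z : U z -> exists W, [/\ G W, W z & W `<=` U].
  move=> Uz; apply: contrapT => noW.
  pose D := [set W | G W /\ W z].
  have FF : ProperFilter (filter_from D (fun W => W `&` ~` U)).
    apply: filter_from_proper.
      apply: filter_from_filter.
        by exists setT; split; [exact: subalgebraT algG|].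
      move=> V W [GV Vz] [GW Wz]; exists (V `&` W).
        by split; [exact: subalgebraI algG _ _ GV GW|].
      by move=> y [[Vy Wy] nUy].
    move=> W [GW Wz]; apply: contrapT => W0; apply: noW; exists W; split => //.
    by move=> y Wy; apply: contrapT => nUy; apply: W0; exists y.
  have FU : filter_from D (fun W => W `&` ~` U) (~` U).
    by exists setT; [split; [exact: subalgebraT algG|]|move=> y []].
  have [z' [nUz' clz']] := cpt _ (open_closedC oU) _ FF FU.
  have [V [GV Vz nVz']] : exists V, [/\ G V, V z & ~ V z'].
    by apply: sep => zz'; apply: nUz'; rewrite -zz'.
  have nbV : nbhs z' (~` V).
    by apply: open_nbhs_nbhs; split => //; exact: closed_openC (Gcl _ GV).2.
  have [] := clz' (V `&` ~` U) (~` V) _ nbV; first by exists V.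
  by move=> y [[]].
(* Same argument with the sets [U `\` W], [W] in [G] contained in [U]. *)
apply: contrapT => nGU.
pose D := [set W | G W /\ W `<=` U].
have FF : ProperFilter (filter_from D (fun W => U `&` ~` W)).
  apply: filter_from_proper.
    apply: filter_from_filter; first by exists set0; split=> [|y []].
    move=> V W [GV VU] [GW WU]; exists (V `|` W).
      by split; [exact: GU|rewrite subUset].
    by move=> y [Uy]; rewrite setCU => -[].
  move=> W [GW WU]; apply: contrapT => W0; apply: nGU.
  suff -> : U = W by [].
  apply/seteqP; split => // y Uy; apply: contrapT => nWy.
  by apply: W0; exists y.
have FU : filter_from D (fun W => U `&` ~` W) U.
  by exists set0; [split=> [|y []]|move=> y []].
have [z [Uz clz]] := cpt _ cU _ FF FU.
have [W [GW Wz WU]] := nbhsG _ Uz.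
have nbW : nbhs z W.
  by apply: open_nbhs_nbhs; split => //; exact: (Gcl _ GW).1.
have [] := clz (U `&` ~` W) W _ nbW; first by exists W.
by move=> y [[]].
Qed.

(** * Topology of the Cantor space *)

Section CantorSpaces.
Context {X : topologicalType} (cantorX : is_cantor_space X).

Lemma cantor_compact : compact [set: X].
Proof.
have [h] := cantorX.
have -> : [set: X] = homeo_inv h @` [set: cantor_space].
  by apply/seteqP; split => // z _; exists (h z); rewrite ?homeo_funK.
apply: continuous_compact cantor_space_compact.
exact/continuous_subspaceT/homeo_inv_continuous.
Qed.

Lemma cantor_separated z z' :
  z <> z' -> exists U : set X, [/\ clopen U, U z & ~ U z'].
Proof.
have [h] := cantorX => zz'.
have hzz' : h z != h z' by apply/eqP => /(can_inj (homeo_funK h)).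
have [U [cU Uz nUz']] := cantor_zero_dimensional hzz'.
by exists (h @^-1` U); split => //; apply: preimage_clopen cU (@homeo_continuous _ _ h).
Qed.

Lemma cantor_infinite : infinite_set [set: X].
Proof.
have [h] := cantorX.
(* The indicator sequences of singletons are infinitely many distinct points. *)
pose e (n : nat) : cantor_space := fun m => m == n.
have injhe : injective (homeo_inv h \o e).
  move=> m n /(can_inj (homeo_invK h)) /(congr1 (@^~ m)).
  by rewrite /e eqxx => /esym/eqP.
move=> finX; apply: infinite_nat.
rewrite -(preimage_setT (homeo_inv h \o e)); apply: finite_preimage finX.
by move=> m n _ _; exact: injhe.
Qed.

End CantorSpaces.

(** * Minimality: factors, dense orbits and return sets *)

Lemma minimal_transfer {X Y : topologicalType} {phi : homeo X X}
    {psi : homeo Y Y} {p : X -> Y} : continuous p -> range p = [set: Y] ->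
  p \o phi = psi \o p -> minimal_system phi -> minimal_system psi.
Proof.
move=> pc prange pE minX C cC invC [y Cy].
have ponto u : exists z, p z = u.
  have [z _ <-] : range p u by rewrite prange.
  by exists z.
have pS z : p (phi z) = psi (p z) by have := congr1 (@^~ z) pE.
have pC : p @^-1` C = [set: X].
  apply: minX; first by move/continuous_closedP: pc; exact.
    apply/seteqP; split => [_ [z Cz <-]|z Cz].
      by rewrite /preimage /= pS -invC; exists (p z).
    (* Invariance is an equality of sets, so [z] also needs a [phi]-preimage inside the preimage of
       [C]; injectivity of [psi] puts it there. *)
    exists (homeo_inv phi z); last exact: homeo_invK.
    move: Cz; rewrite /preimage /= -{1}invC -{1}(homeo_invK phi z) pS.
    by move=> [c Cc /(can_inj (homeo_funK psi)) <-].
  by have [z pz] := ponto y; exists z; rewrite /preimage /= pz.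
apply/seteqP; split => // u _; have [z <-] := ponto u.
by have : (p @^-1` C) z by rewrite pC.
Qed.

(** The points whose whole orbit avoids [U] form a closed invariant set. If [x] were among them,
    this set would be everything, although it misses [U]. *)
Lemma orbit_dense {X : topologicalType} (phi : homeo X X) (x : X) :
  minimal_system phi ->
  forall U, open U -> U !=set0 -> exists i, U (homeo_pow phi i x).
Proof.
move=> minX U oU [z Uz]; apply: contrapT => noU.
pose C := [set y | forall i, ~ U (homeo_pow phi i y)].
have cC : closed C.
  have -> : C = \bigcap_(i in [set: int]) (homeo_pow phi i @^-1` ~` U).
    by apply/seteqP; split => y Cy i => [_|]; apply: Cy.
  apply: closed_bigI => i _.
  move/continuous_closedP: (@homeo_pow_continuous _ phi i); apply.
  exact: open_closedC.
have powS i y : homeo_pow phi i (phi y) = homeo_pow phi (i + 1)%R y.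
  by rewrite homeo_powD.
have invC : invariant_set phi C.
  apply/seteqP; split => [_ [y Cy <-] i|y Cy]; first by rewrite powS; exact: Cy.
  exists (homeo_inv phi y); last exact: homeo_invK.
  by move=> i; rewrite -(GRing.subrK 1%R i) -powS homeo_invK; exact: Cy.
have CT : C = [set: X].
  by apply: minX => //; exists x => i Ui; apply: noU; exists i.
have Cz : C z by rewrite CT.
exact: Cz 0%R Uz.
Qed.

(** If the open set [U] minus [V] is non-empty, the dense orbit of [x] visits it, at a time that
    lies in the return set of [U] only. *)
Lemma ret_set_inj {X : topologicalType} (phi : homeo X X) (x : X) :
  minimal_system phi -> set_inj (@clopen X) (ret_set phi x).
Proof.
move=> minX.
have sub U V : clopen U -> clopen V -> ret_set phi x U = ret_set phi x V ->
    U `<=` V.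
  move=> [oU _] [_ cV] UV z Uz; apply: contrapT => nVz.
  have [i [Ui]] : exists i, (U `&` ~` V) (homeo_pow phi i x).
    apply: orbit_dense => //; last by exists z.
    by apply: openI => //; exact: closed_openC.
  apply; rewrite -[V (homeo_pow phi i x)]/(ret_set phi x V i) -UV.
  exact: Ui.
by move=> U V /set_mem cU /set_mem cV UV; apply/seteqP; split; exact: sub.
Qed.

(** * Subshifts have finitely generated return algebras *)

Lemma full_shift_hausdorff (A : finType) : hausdorff_space (full_shift A).
Proof.
by apply: (@hausdorff_product _ (fun=> discrete_topology A)) => i;
  exact: discrete_hausdorff.
Qed.

Lemma cylinder_clopen (A : finType) (i : int) (B : set A) :
  clopen [set u : full_shift A | B (u i)].
Proof.
have cl : clopen (B : set (discrete_topology A)).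
  by split; [exact: discrete_open|exact: discrete_closed].
apply: (preimage_clopen (f := @^~ i : full_shift A -> discrete_topology A) cl).
exact: (@proj_continuous _ (fun=> discrete_topology A)).
Qed.

Lemma shift_pow (A : finType) (k i : int) (u : full_shift A) :
  homeo_pow (shift A) k u i = u (i + k)%R.
Proof.
rewrite /homeo_pow; elim/int_rect: k i => [i|n IH i|n IH i].
- by rewrite GRing.addr0.
- rewrite -addn1 PoszD (ziterS (@shift_invK A)).
  by apply: etrans (IH _) _; rewrite -GRing.addrA (GRing.addrC 1%R).
- rewrite -addn1 PoszD GRing.opprD (ziterP (@shift_funK A) (@shift_invK A)).
  by apply: etrans (IH _) _; rewrite -GRing.addrA (GRing.addrC (-1)%R).
Qed.

Lemma val_pow {X : topologicalType} {phi : homeo X X} {O : set X}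
    (invO : invariant_set phi O) (i : int) (u : O) :
  val (homeo_pow (homeo_restr invO) i u) = homeo_pow phi i (val u).
Proof. exact: (@pow_conjugate O X (homeo_restr invO) phi val erefl). Qed.

Lemma val_continuous {X : topologicalType} (O : set X) :
  continuous (val : O -> X).
Proof. by apply/continuousP => B oB; exists B. Qed.

Lemma subshift_ret_finitely_generated {X : topologicalType} (phi : homeo X X)
    (x : X) (A : finType) (O : set (full_shift A)) (sO : is_subshift O) (w : O) :
  compact [set: X] ->
  pointed_conjugate phi x (homeo_restr (proj2 sO)) w ->
  finitely_generated (ret phi x).
Proof.
move=> cX [p [pE px]].
(* The cylinders at coordinate 0, pulled back to [X]; their translates under [phi] give the
   cylinders at all other coordinates. *)
pose letter a := [set z : X | val (p z) 0%R = a].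
have letter_clopen a : clopen (letter a).
  have pc : continuous (val \o p : X -> full_shift A).
    by move=> z; apply: continuous_comp;
      [exact: homeo_continuous|exact: val_continuous].
  exact (preimage_clopen (cylinder_clopen A 0%R [set a]) pc).
have letter_pow a k z :
    (homeo_pow phi k @^-1` letter a) z <-> val (p z) k = a.
  by rewrite /letter /preimage /= (pow_conjugate pE) val_pow shift_pow GRing.add0r.
pose F := [set ret_set phi x (letter a) | a in [set: A]].
exists F; split.
- exact/finite_image/finite_finset.
- by move=> _ [a _ <-]; exists (letter a).
apply/seteqP; split; last first.
  apply: smallest_sub; first exact: ret_subalgebra.
  move=> _ [_ [a _ <-] [k _ <-]]; exists (homeo_pow phi k @^-1` letter a).
    exact: preimage_clopen (letter_clopen a) (@homeo_pow_continuous _ phi k).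
  exact: ret_set_preimage.
move=> _ [U cU <-].
set G := smallest _ _.
(* The clopen sets with return set in the generated algebra form a subalgebra, so it remains to see
   that it separates points. *)
have := @separating_algebra_clopen X
  [set U | clopen U /\ G (ret_set phi x U)] cX.
case/(_ _ _ _ U cU) => //.
- exact/preimage_ret_subalgebra/smallest_subalgebra.
- by move=> V [].
move=> z z' zz'.
have [k kzz'] : exists k, val (p z) k <> val (p z') k.
  apply: contrapT => nk; apply: zz'; apply: (can_inj (homeo_funK p)).
  apply: val_inj; apply/funext => k.
  by apply: contrapT => kzz'; apply: nk; exists k.
(* The points that read the same letter as [z] at coordinate [k], where [z'] reads another one. *)
exists (homeo_pow phi k @^-1` letter (val (p z) k)); split.
- split.
    exact: preimage_clopen (letter_clopen _) (@homeo_pow_continuous _ phi k).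
  rewrite ret_set_preimage; apply: sub_smallest (@subset_refl _ _) _ _.
  by exists (ret_set phi x (letter (val (p z) k))); [exists (val (p z) k)|exists k].
- exact/letter_pow.
- by move/letter_pow => /esym.
Qed.

(** * Coding a system by a finite partition *)

Section Coding.
Context {X : topologicalType} (phi : homeo X X) {A : finType} (c : X -> A).

(** The itinerary of [z] through the fibres of [c]. *)
Definition coding (z : X) : full_shift A := fun i => c (homeo_pow phi i z).

Lemma coding_shift : coding \o phi = shift A \o coding.
Proof.
apply/funext => z; apply/funext => i /=.
by rewrite /shift_fun /coding homeo_powD.
Qed.

(** The pointwise topology is a supremum of initial topologies, so continuity is checked one
    coordinate at a time. *)
Lemma coding_continuous : (forall a, open (c @^-1` [set a])) ->
  continuous coding.
Proof.
move=> oc z.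
have FF : Filter (coding @ nbhs z) by apply: fmap_filter.
refine (iffRL (@cvg_sup _ _ _ _ _ FF) _).
move=> i /=; clear FF; move: z.
apply/(@continuousP _ (initial_topology (@^~ i))) => _ [B oB <-].
rewrite (_ : _ @^-1` _ = homeo_pow phi i @^-1` (c @^-1` B)) //.
move/continuousP: (@homeo_pow_continuous _ phi i); apply.
rewrite (_ : c @^-1` B = \bigcup_(a in B) (c @^-1` [set a])).
  by apply: bigcup_open => a _; exact: oc.
apply/seteqP; split => [y By|y [a Ba /= cya]]; first by exists (c y).
by rewrite /preimage /= cya.
Qed.

Lemma range_coding_invariant : invariant_set (shift A) (range coding).
Proof.
have cE z : coding (phi z) = shift A (coding z).
  by have := congr1 (@^~ z) coding_shift.
apply/seteqP; split => [_ [_ [z _ <-] <-]|_ [z _ <-]].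
  by exists (phi z).
exists (coding (homeo_inv phi z)); first by exists (homeo_inv phi z).
by rewrite -cE homeo_invK.
Qed.

End Coding.

(** Closed subsets of [X] are compact, so their images are compact and hence closed in [Y]; this
    makes the inverse continuous. *)
Lemma injective_range_homeo {X Y : topologicalType} (p : X -> Y) :
  compact [set: X] -> hausdorff_space Y -> continuous p -> injective p ->
  exists h : homeo X (range p), forall z, val (h z) = p z.
Proof.
move=> cX hY pc pinj.
pose f z : range p := exist _ (p z) (mem_set (imageT p z)).
pose g (u : range p) : X := projT1 (cid2 (set_valP u)).
have pg u : p (g u) = val u by rewrite /g; case: cid2.
have fK : cancel f g by move=> z; apply: pinj; rewrite pg.
have gK : cancel g f by move=> u; apply: val_inj; rewrite /= pg.
have fc : continuous f.
  by apply/continuousP => _ [B oB <-]; move/continuousP: pc; apply.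
have gc : continuous g.
  apply/continuous_closedP => C cC.
  have -> : g @^-1` C = val @^-1` (p @` C).
    apply/seteqP; split => u; first by move=> Cgu; exists (g u).
    move=> [z Cz pz]; rewrite /preimage /=.
    by rewrite (_ : u = f z) ?fK //; apply: val_inj.
  move/continuous_closedP: (@val_continuous _ (range p)); apply.
  apply: compact_closed => //; apply: continuous_compact.
    exact: continuous_subspaceT.
  exact: (subclosed_compact cC cX).
by exists (Homeo fK gK fc gc).
Qed.

(** The range of the coding is compact, hence closed; it inherits minimality through the
    homeomorphism and infinitude through injectivity. *)
Lemma coding_conjugate {X : topologicalType} (phi : homeo X X) (x : X)
    {A : finType} (c : X -> A) :
  compact [set: X] -> infinite_set [set: X] -> minimal_system phi ->
  (forall a, open (c @^-1` [set a])) -> injective (coding phi c) ->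
  exists (O : set (full_shift A)) (sO : is_subshift O) (w : O),
    is_minimal_subshift sO /\
    pointed_conjugate phi x (homeo_restr (proj2 sO)) w.
Proof.
move=> cX infX minX oc inj.
have cc := @coding_continuous _ phi _ _ oc.
have [h hE] := injective_range_homeo _ cX (full_shift_hausdorff A) cc inj.
have clO : closed (range (coding phi c)).
  apply: compact_closed; first exact: full_shift_hausdorff.
  by apply: continuous_compact cX; exact: continuous_subspaceT.
pose sO : is_subshift (range (coding phi c)) :=
  conj clO (range_coding_invariant phi c).
have hS : h \o phi = homeo_restr (proj2 sO) \o h.
  apply/funext => z; apply: val_inj; rewrite /= !hE.
  exact (congr1 (@^~ z) (coding_shift phi c)).
exists (range (coding phi c)), sO, (h x); split; last by exists h.
split.
  apply: minimal_transfer hS minX; first exact: homeo_continuous.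
  by apply/seteqP; split => // u _; exists (homeo_inv h u); rewrite ?homeo_invK.
move=> /(finite_preimage (f := coding phi c) (in2W inj)).
by rewrite preimage_range; exact: infX.
Qed.

Lemma finitely_generated_ret_subshift {X : topologicalType} (phi : homeo X X)
    (x : X) :
  compact [set: X] -> infinite_set [set: X] ->
  (forall z z', z <> z' -> exists U : set X, [/\ clopen U, U z & ~ U z']) ->
  minimal_system phi -> finitely_generated (ret phi x) ->
  exists (A : finType) (O : set (full_shift A)) (sO : is_subshift O) (w : O),
    is_minimal_subshift sO /\
    pointed_conjugate phi x (homeo_restr (proj2 sO)) w.
Proof.
move=> cX infX sepX minX [F [/finite_seqP[s ->] Fret retE]].
(* One clopen set is chosen for each generator; off the list [s] the value [set0] is a mere
   default. *)
have /choice [U UE] : forall B, exists U,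
    B \in s -> clopen U /\ ret_set phi x U = B.
  move=> B; have [Bs|nBs] := boolP (B \in s); last by exists set0.
  by have [U cU <-] := Fret _ Bs; exists U.
(* The letter of [z] records which of the chosen clopen sets contain it. *)
pose c (z : X) := [ffun j : 'I_(size s) => `[< U (nth set0 s j) z >]].
exists {ffun 'I_(size s) -> bool}; apply: (@coding_conjugate _ _ _ _ c) => //.
  move=> a.
  (* A fibre of [c] is a finite intersection of chosen sets and complements of chosen sets. *)
  rewrite (_ : _ @^-1` _ =
    \bigcap_(j in [set: 'I_(size s)])
      (if a j then U (nth set0 s j) else ~` U (nth set0 s j))); last first.
    apply/seteqP; split => [z <- j _|z Uaz]; first by rewrite ffunE; case: asboolP.
    apply/ffunP => j; rewrite ffunE; have := Uaz j I.
    by case: (a j) => ?; [exact: asboolT|exact: asboolF].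
  rewrite -[X in open X]setCK setC_bigcap; apply: closed_openC.
  apply: closed_bigcup => [|j _]; first exact: finite_finset.
  have [cU _] := UE _ (mem_nth set0 (ltn_ord j)).
  apply: open_closedC; case: (a j); first exact: cU.1.
  exact: (clopenC setT cU).1.
move=> z z' zz'; apply: contrapT => nzz'.
have [V [cV Vz nVz']] := sepX _ _ nzz'.
(* The return sets of clopen sets that do not tell [z] from [z']. Once [G] is a subalgebra
   containing the translated generators, it contains the return set of [V], and [ret_set_inj] turns
   the witness [W] into [V] itself. *)
pose G := [set B | exists W, [/\ clopen W, ret_set phi x W = B & W z <-> W z']].
suff GV : G (ret_set phi x V).
  have [W [cW WV WW]] := GV; apply: nVz'.
  have WeqV := ret_set_inj _ _ minX _ _ (mem_set cW) (mem_set cV) WV.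
  by move: WW; rewrite WeqV => <-.
have : ret phi x (ret_set phi x V) by exists V.
rewrite retE; apply.
case: (clopen_subalgebra X) => cl0 clU clC.
split.
  split.
  - by exists set0.
  - move=> _ _ [W [cW <- WW]] [W' [cW' <- WW']]; exists (W `|` W').
    by split; [exact: clU| |rewrite /setU /=; tauto].
  - move=> _ [W [cW <- WW]]; exists (~` W).
    by split; [exact: clC| |rewrite /setC /=; tauto].
move=> _ [B Bs [k _ <-]]; have [cUB UB] := UE _ Bs.
exists (homeo_pow phi k @^-1` U B); split.
- exact: preimage_clopen cUB (@homeo_pow_continuous _ phi k).
- by rewrite ret_set_preimage UB.
(* Coordinate [k] of the common code, read at the index of [B], says that [z] and [z'] visit [U B]
   together at time [k]. *)
have sB : (index B s < size s)%N by rewrite index_mem.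
have cE : c (homeo_pow phi k z) = c (homeo_pow phi k z') := congr1 (@^~ k) zz'.
move/ffunP/(_ (Ordinal sB)): cE; rewrite !ffunE /= nth_index // => UzE.
by split=> /asboolP Uz; apply/asboolP; rewrite ?UzE // -UzE.
Qed.

Theorem theorem3p5 (X : topologicalType) (phi : homeo X X) (x : X)
    (cantorX : is_cantor_space X) (minX : minimal_system phi) :
  (exists (A : finType) (O : set (full_shift A)) (sO : is_subshift O) (w : O),
      is_minimal_subshift sO /\
      pointed_conjugate phi x (homeo_restr (proj2 sO)) w)
  <-> finitely_generated (ret phi x).
Proof.
have cX := cantor_compact cantorX.
split=> [[A [O [sO [w [_ conj]]]]]|].
  exact: subshift_ret_finitely_generated cX conj.
apply: finitely_generated_ret_subshift => //.
- exact: cantor_infinite.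
- exact: cantor_separated.
Qed.
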